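(* For any positive integer $d$, $$\omega\big(H^{[d]}(t)\big)=\big(H^{[d]}(-t)\big)^{-1}.$$ In particular, $\omega(E(t))=H(t)$.
   Context: $\Lambda$ is the ring of symmetric functions over $\mathbb{Q}$ in the variables $x=(x_1,x_2,\ldots)$. For a positive integer $d$, $H^{[d]}(t)=\sum_{n\ge 0}h_n^{[d]}(x)t^n=\prod_{k\ge 1}(1+x_kt+x_k^2t^2+\cdots+x_k^dt^d)\in\Lambda[[t]]$. $E(t)=H^{[1]}(t)=\sum_{n\ge0}e_nt^n$ and $H(t)=E(-t)^{-1}=\sum_{n\ge0}h_nt^n$ are the generating functions of the elementary and complete homogeneous symmetric functions. $\omega:\Lambda\to\Lambda$ is the algebra involution with $\omega(e_n)=h_n$ for all $n$, applied to power series in $t$ coefficientwise. *)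

(* Defs.v *)
From HB Require Import structures.
From mathcomp Require Import all_boot all_order all_fingroup all_algebra.
From mathcomp Require Import mpoly.
From mathcomp Require Import boolp.

Set Implicit Arguments.
Unset Strict Implicit.
Unset Printing Implicit Defensive.

Import GRing.Theory.
Local Open Scope ring_scope.

(* Formal power series R[[t]].  The record keeps the type apart from
   nat -> R, whose library ring structure is the pointwise one. *)

Record fps (R : Type) := Fps { fcoef : nat -> R }.

HB.instance Definition _ (R : Type) := gen_eqMixin (fps R).
HB.instance Definition _ (R : Type) := gen_choiceMixin (fps R).

Lemma fpsP (R : Type) (f g : fps R) : (forall n, fcoef f n = fcoef g n) -> f = g.
Proof. by case: f g => [f] [g] /= /funext ->. Qed.

Definition map_fps (A B : Type) (u : A -> B) (f : fps A) : fps B :=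
  Fps (fun n => u (fcoef f n)).

Section FpsRing.
Variable R : comNzRingType.
Implicit Types f g h : fps R.

Definition fps0 : fps R := Fps (fun=> 0).
Definition fps1 : fps R := Fps (fun n => (n == 0%N)%:R).
Definition fps_opp f := Fps (fun n => - fcoef f n).
Definition fps_add f g := Fps (fun n => fcoef f n + fcoef g n).
Definition fps_mul f g :=
  Fps (fun n => \sum_(j < n.+1) fcoef f j * fcoef g (n - j)).

Fact fps_addA : associative fps_add.
Proof. by move=> f g h; apply: fpsP => n /=; rewrite addrA. Qed.
Fact fps_addC : commutative fps_add.
Proof. by move=> f g; apply: fpsP => n /=; rewrite addrC. Qed.
Fact fps_add0 : left_id fps0 fps_add.
Proof. by move=> f; apply: fpsP => n /=; rewrite add0r. Qed.
Fact fps_addN : left_inverse fps0 fps_opp fps_add.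
Proof. by move=> f; apply: fpsP => n /=; rewrite addNr. Qed.

HB.instance Definition _ :=
  GRing.isZmodule.Build (fps R) fps_addA fps_addC fps_add0 fps_addN.

Let trunc N f : {poly R} := \poly_(i < N) fcoef f i.

Let coef_fps_mul N f g n : (n < N)%N ->
  fcoef (fps_mul f g) n = (trunc N f * trunc N g)`_n.
Proof.
move=> ltnN; rewrite coefM; apply: eq_bigr => j _.
by rewrite !coef_poly (leq_ltn_trans (leq_subr _ _) ltnN)
  (leq_ltn_trans _ ltnN) // -ltnS.
Qed.

Fact fps_mulA : associative fps_mul.
Proof.
move=> f g h; apply: fpsP => n; set N := n.+1.
transitivity ((trunc N f * (trunc N g * trunc N h))`_n).
  rewrite coefM; apply: eq_bigr => j _.
  by rewrite (@coef_fps_mul N) ?ltnS ?leq_subr // coef_poly ltn_ord.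
rewrite mulrA coefM; apply: eq_bigr => j _.
by rewrite (@coef_fps_mul N) // coef_poly ltnS leq_subr.
Qed.
Fact fps_mulC : commutative fps_mul.
Proof.
by move=> f g; apply: fpsP => n; rewrite !(@coef_fps_mul n.+1) // mulrC.
Qed.
Fact fps_mul1 : left_id fps1 fps_mul.
Proof.
move=> f; apply: fpsP => n /=; rewrite big_ord_recl /= mul1r subn0.
by rewrite big1 ?addr0 // => i _; rewrite mul0r.
Qed.
Fact fps_mulDl : left_distributive fps_mul fps_add.
Proof.
move=> f g h; apply: fpsP => n /=; rewrite -big_split /=.
by apply: eq_bigr => j _; rewrite mulrDl.
Qed.
Fact fps1_neq0 : fps1 != 0 :> fps R.
Proof.
by apply/eqP => /(congr1 (fun f => fcoef f 0)) /eqP; rewrite oner_eq0.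
Qed.

HB.instance Definition _ := GRing.Zmodule_isComNzRing.Build (fps R)
  fps_mulA fps_mulC fps_mul1 fps_mulDl fps1_neq0.

(* Units are the series that have an inverse, and f^-1 is that inverse. *)

Definition fps_unit : pred (fps R) := fun f => `[< exists g, g * f = 1 >].
Definition fps_inv f : fps R :=
  if pselect (exists g, g * f = 1) is left invf then sval (cid invf) else f.

Fact fps_mulVr : {in fps_unit, left_inverse 1 fps_inv *%R}.
Proof.
move=> f /asboolP invf; rewrite /fps_inv.
by case: pselect => // e; case: cid.
Qed.
Fact fps_unitPl f g : g * f = 1 -> fps_unit f.
Proof. by move=> gf1; apply/asboolP; exists g. Qed.
Fact fps_inv_out : {in [predC fps_unit], fps_inv =1 id}.
Proof. by move=> f /asboolPn invf; rewrite /fps_inv; case: pselect. Qed.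

HB.instance Definition _ := GRing.ComNzRing_hasMulInverse.Build (fps R)
  fps_mulVr fps_unitPl fps_inv_out.

(* f(t) |-> f(-t) *)
Definition fps_reflect f : fps R := Fps (fun n => (-1) ^+ n * fcoef f n).

Lemma fps_unit_coef0 f : fcoef f 0 = 1 -> f \is a GRing.unit.
Proof.
move=> f0.
pose step s := rcons s (- \sum_(j < size s) s`_j * fcoef f (size s - j)).
pose s n := iter n step [:: 1].
pose g := Fps (fun n => (s n)`_n).
have size_s n : size (s n) = n.+1.
  by elim: n => //= n IHn; rewrite size_rcons IHn.
have s_stable n m j : (j <= n)%N -> (s (m + n)%N)`_j = (s n)`_j.
  move=> lejn; elim: m => //= m IHm.
  by rewrite nth_rcons size_s ltnS (leq_trans lejn (leq_addl _ _)).
apply: (@fps_unitPl _ g); apply: fpsP => -[|n] /=.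
  by rewrite big_ord1 f0 mul1r.
rewrite big_ord_recr /= subnn f0 mulr1 nth_rcons size_s ltnn eqxx.
apply/eqP; rewrite subr_eq0; apply/eqP/eq_bigr => -[j ltj] _ /=.
by congr (_ * _); rewrite -(@s_stable j (n - j)%N j) // subnK // -ltnS.
Qed.

End FpsRing.

(* The ring of symmetric functions over Q as an inverse limit: a symmetric
   function is a family of symmetric polynomials f_N(x_0, ..., x_(N-1)) of
   bounded degree, with f_(N+1)(x_0, ..., x_(N-1), 0) = f_N. *)

Definition mrestrict_vars N : N.+1.-tuple {mpoly rat[N]} :=
  [tuple if unlift ord_max i is Some j then 'X_j else 0 | i < N.+1].

Definition mrestrict N (p : {mpoly rat[N.+1]}) : {mpoly rat[N]} :=
  p \mPo mrestrict_vars N.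

HB.instance Definition _ N := GRing.LRMorphism.copy (@mrestrict N)
  (@comp_mpoly N.+1 rat N (mrestrict_vars N)).

Definition is_symfun (f : forall N, {mpoly rat[N]}) : Prop :=
  [/\ forall N, f N \is symmetric,
      forall N, mrestrict (f N.+1) = f N
    & exists D, forall N, (msize (f N) <= D)%N].

Record symfun := SymFun {
  sf_poly :> forall N, {mpoly rat[N]};
  sf_polyP : is_symfun sf_poly }.

HB.instance Definition _ := gen_eqMixin symfun.
HB.instance Definition _ := gen_choiceMixin symfun.

Lemma symfunP (f g : symfun) : (forall N, f N = g N) -> f = g.
Proof.
case: f g => [f fP] [g gP] /= fg.
have {}fg : f = g by apply: functional_extensionality_dep.
by case: g / fg gP => gP; congr SymFun; apply: Prop_irrelevance.
Qed.

Section SymFunAlgebra.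
Implicit Types f g h : symfun.

Fact symfun0_subproof : is_symfun (fun=> 0).
Proof.
by split=> [N|N|]; [exact: rpred0 | rewrite raddf0 | exists 0%N => N; rewrite msize0].
Qed.
Fact symfun1_subproof : is_symfun (fun=> 1).
Proof.
by split=> [N|N|]; [exact: rpred1 | rewrite rmorph1 | exists 1%N => N; rewrite msize1].
Qed.
Fact symfun_opp_subproof f : is_symfun (fun N => - f N).
Proof.
case: f => f /= [fS fR [D fD]]; split=> [N|N|]; first by rewrite rpredN; apply: fS.
  by rewrite raddfN /= fR.
by exists D => N; rewrite msizeN.
Qed.
Fact symfun_add_subproof f g : is_symfun (fun N => f N + g N).
Proof.
case: f g => f [fS fR [D fD]] [g [gS gR [C gC]]] /=.
split=> [N|N|]; [by apply: rpredD; [apply: fS | apply: gS] | by rewrite raddfD /= fR gR |].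
exists (maxn D C) => N; apply: leq_trans (msizeD_le _ _) _.
by rewrite geq_max !leq_max fD gC orbT.
Qed.
Fact symfun_mul_subproof f g : is_symfun (fun N => f N * g N).
Proof.
case: f g => f [fS fR [D fD]] [g [gS gR [C gC]]] /=.
split=> [N|N|]; [by apply: rpredM; [apply: fS | apply: gS] | by rewrite rmorphM /= fR gR |].
exists (D + C)%N => N; apply: leq_trans (leq_add (fD N) (gC N)).
have [->|f0] := eqVneq (f N) 0; first by rewrite mul0r msize0.
have [->|g0] := eqVneq (g N) 0; first by rewrite mulr0 msize0.
by rewrite msizeM // leq_pred.
Qed.
Fact symfun_scale_subproof c f : is_symfun (fun N => c *: f N).
Proof.
case: f => f /= [fS fR [D fD]]; split=> [N|N|]; first by apply: rpredZ; apply: fS.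
  by rewrite linearZ /= fR.
by exists D => N; apply: leq_trans (msizeZ_le _ _) (fD N).
Qed.

Definition symfun0 := SymFun symfun0_subproof.
Definition symfun1 := SymFun symfun1_subproof.
Definition symfun_opp f := SymFun (symfun_opp_subproof f).
Definition symfun_add f g := SymFun (symfun_add_subproof f g).
Definition symfun_mul f g := SymFun (symfun_mul_subproof f g).
Definition symfun_scale c f := SymFun (symfun_scale_subproof c f).

Fact symfun_addA : associative symfun_add.
Proof. by move=> f g h; apply: symfunP => N /=; rewrite addrA. Qed.
Fact symfun_addC : commutative symfun_add.
Proof. by move=> f g; apply: symfunP => N /=; rewrite addrC. Qed.
Fact symfun_add0 : left_id symfun0 symfun_add.
Proof. by move=> f; apply: symfunP => N /=; rewrite add0r. Qed.
Fact symfun_addN : left_inverse symfun0 symfun_opp symfun_add.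
Proof. by move=> f; apply: symfunP => N /=; rewrite addNr. Qed.

HB.instance Definition _ := GRing.isZmodule.Build symfun
  symfun_addA symfun_addC symfun_add0 symfun_addN.

Fact symfun_mulA : associative symfun_mul.
Proof. by move=> f g h; apply: symfunP => N /=; rewrite mulrA. Qed.
Fact symfun_mulC : commutative symfun_mul.
Proof. by move=> f g; apply: symfunP => N /=; rewrite mulrC. Qed.
Fact symfun_mul1 : left_id symfun1 symfun_mul.
Proof. by move=> f; apply: symfunP => N /=; rewrite mul1r. Qed.
Fact symfun_mulDl : left_distributive symfun_mul symfun_add.
Proof. by move=> f g h; apply: symfunP => N /=; rewrite mulrDl. Qed.
Fact symfun1_neq0 : symfun1 != 0.
Proof.
by apply/eqP => /(congr1 (fun f : symfun => f 0%N)) /eqP; rewrite oner_eq0.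
Qed.

HB.instance Definition _ := GRing.Zmodule_isComNzRing.Build symfun
  symfun_mulA symfun_mulC symfun_mul1 symfun_mulDl symfun1_neq0.

Fact symfun_scaleA c d f :
  symfun_scale c (symfun_scale d f) = symfun_scale (c * d) f.
Proof. by apply: symfunP => N /=; rewrite scalerA. Qed.
Fact symfun_scale1 : left_id 1 symfun_scale.
Proof. by move=> f; apply: symfunP => N /=; rewrite scale1r. Qed.
Fact symfun_scaleDr : right_distributive symfun_scale +%R.
Proof. by move=> c f g; apply: symfunP => N /=; rewrite scalerDr. Qed.
Fact symfun_scaleDl f : {morph symfun_scale^~ f : c d / c + d}.
Proof. by move=> c d; apply: symfunP => N /=; rewrite scalerDl. Qed.

HB.instance Definition _ := GRing.Zmodule_isLmodule.Build rat symfun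
  symfun_scaleA symfun_scale1 symfun_scaleDr symfun_scaleDl.

Fact symfun_scaleAl c f g : c *: (f * g) = c *: f * g.
Proof. by apply: symfunP => N /=; rewrite scalerAl. Qed.

HB.instance Definition _ := GRing.Lmodule_isLalgebra.Build rat symfun
  symfun_scaleAl.
HB.instance Definition _ := GRing.Lalgebra_isComAlgebra.Build rat symfun.

End SymFunAlgebra.

(* The N-variable truncation of the product defining H^[d](t), as a
   polynomial in t. *)
Definition Hd_poly (d N : nat) : {poly {mpoly rat[N]}} :=
  \prod_(k < N) \sum_(i < d.+1) ('X_k ^+ i) *: 'X^i.

Fact hd_subproof d n : is_symfun (fun N => (Hd_poly d N)`_n).
Proof.
split=> [N|N|].
- apply/issymP => s; rewrite -coef_map /=.
  suff -> : map_poly (msym s) (Hd_poly d N) = Hd_poly d N by [].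
  rewrite /Hd_poly rmorph_prod /= [RHS](reindex_inj (@perm_inj _ s)) /=.
  apply: eq_bigr => k _; rewrite rmorph_sum /=; apply: eq_bigr => i _.
  by rewrite map_polyZ /= map_polyXn rmorphXn /= /msym mmapX mmap1U.
- rewrite -coef_map /=.
  suff -> : map_poly (@mrestrict N) (Hd_poly d N.+1) = Hd_poly d N by [].
  rewrite /Hd_poly rmorph_prod /= big_ord_recr /= [X in _ * X](_ : _ = 1).
    rewrite mulr1; apply: eq_bigr => k _; rewrite rmorph_sum /=.
    apply: eq_bigr => i _; rewrite map_polyZ /= map_polyXn rmorphXn /=.
    rewrite /mrestrict comp_mpolyXU -tnth_nth tnth_mktuple.
    have -> : widen_ord (leqnSn N) k = lift ord_max k.
      by apply: val_inj; rewrite /= /bump leqNgt ltn_ord.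
    by rewrite liftK.
  rewrite rmorph_sum /= big_ord_recl /= big1 => [|i _].
    by rewrite !expr0 scale1r rmorph1 addr0.
  rewrite map_polyZ /= map_polyXn rmorphXn /= /mrestrict comp_mpolyXU -tnth_nth.
  by rewrite tnth_mktuple unlift_none expr0n scale0r.
exists n.+1 => N.
pose P (p : {poly {mpoly rat[N]}}) := forall m, (msize p`_m <= m.+1)%N.
suff: P (Hd_poly d N) by [].
have msize_sumP (I : finType) (F : I -> {mpoly rat[N]}) b :
    (forall i, msize (F i) <= b)%N -> (msize (\sum_i F i) <= b)%N.
  move=> leFb; apply: leq_trans (msize_sum _ _ _) _.
  by apply/bigmax_leqP.
rewrite /Hd_poly; apply: big_ind => [m|p q Pp Pq m|k _ m].
- by rewrite coef1; case: m => [|m]; rewrite ?msize1 ?msize0.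
- rewrite coefM; apply: msize_sumP => j.
  have [->|p0] := eqVneq p`_j 0; first by rewrite mul0r msize0.
  have [->|q0] := eqVneq q`_(m - j) 0; first by rewrite mulr0 msize0.
  rewrite msizeM // -ltnS prednK ?addn_gt0 ?lt0n ?msize_poly_eq0 ?p0 //.
  apply: leq_trans (leq_add (Pp j) (Pq _)) _.
  by rewrite addSn addnS subnKC // -ltnS.
rewrite coef_sum; apply: msize_sumP => i.
rewrite coefZ coefXn; case: eqP => [->|_]; last by rewrite mulr0 msize0.
by rewrite mulr1 mpolyXn msizeX mdegMn mdeg1 mul1n.
Qed.

Definition hd (d n : nat) : symfun := SymFun (hd_subproof d n).

Definition Hd (d : nat) : fps symfun := Fps (hd d).

Definition Eseries : fps symfun := Hd 1.
Definition Hseries : fps symfun := (fps_reflect Eseries)^-1.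

Definition sf_e (n : nat) : symfun := fcoef Eseries n.
Definition sf_h (n : nat) : symfun := fcoef Hseries n.

Lemma Hd_reflect_unit d : fps_reflect (Hd d) \is a GRing.unit.
Proof.
apply: fps_unit_coef0; rewrite [LHS]mul1r; apply: symfunP => N /=.
rewrite -horner_coef0 /Hd_poly horner_prod big1 // => k _.
rewrite horner_sum big_ord_recl /= big1 => [|i _].
  by rewrite !expr0 hornerZ hornerC mulr1 addr0.
by rewrite hornerZ hornerXn expr0n mulr0.
Qed.

Lemma sf_eE n N : sf_e n N = mesym N rat n.
Proof.
rewrite /= /Hd_poly.
under eq_bigr => k _ do
  rewrite big_ord_recl big_ord1 /= expr0 scale1r addrC.
rewrite bigA_distr coef_sum /= /mesym [RHS]big_mkcond /=; apply: eq_bigr => J _.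
rewrite -big_mkcond /= scaler_prod prodr_const expr1 coefZ coefXn eq_sym.
by case: eqP => _; rewrite ?mulr1 ?mulr0.
Qed.

(* Main.v *)
(** Let D = t d/dt.  If D g = g C for the one-variable series
    g(t) = 1 + t + ... + t^d, with C(t) = sum_n c_n t^n, then the logarithmic
    derivative turns the product H^[d](t) = prod_k g(x_k t) into the sum
    D H^[d] = H^[d] * sum_n c_n p_n t^n, where p_n is the n-th power sum.
    For d = 1 all c_n with n > 0 are nonzero, so comparing the logarithmic
    derivatives of omega(E(t)) = H(t) = E(-t)^-1 gives
    omega(p_n) = (-1)^(n-1) p_n.  For arbitrary d the logarithmic derivatives
    of omega(H^[d](t)) and H^[d](-t) are then opposite, so their product is
    constant, equal to 1. *)
Require Import Defs.
From HB Require Import structures.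
From mathcomp Require Import all_boot all_order all_fingroup all_algebra.
From mathcomp Require Import mpoly.
Import GRing.Theory.
Local Open Scope ring_scope.

(** * Power series and the operator D = t d/dt *)

Section FpsOperations.
Variable R : comNzRingType.
Implicit Types (f g s : fps R) (x : R).

Lemma fcoefM f g n : fcoef (f * g) n = \sum_(j < n.+1) fcoef f j * fcoef g (n - j).
Proof. by []. Qed.

Lemma fcoef_sum (I : Type) (r : seq I) (F : I -> fps R) n :
  fcoef (\sum_(i <- r) F i) n = \sum_(i <- r) fcoef (F i) n.
Proof. by elim/big_rec2: _ => // i y z _ <-. Qed.

Lemma fcoef0M f g : fcoef (f * g) 0 = fcoef f 0 * fcoef g 0.
Proof. by rewrite fcoefM big_ord1. Qed.

(** The substitution t -> x t; [fps_reflect] is convertible to the case x = -1. *)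
Definition fps_dilate x f : fps R := Fps (fun n => x ^+ n * fcoef f n).

Lemma fps_dilateM x f g :
  fps_dilate x (f * g) = fps_dilate x f * fps_dilate x g.
Proof.
apply: fpsP => n; rewrite fcoefM /= mulr_sumr; apply: eq_bigr => j _.
by rewrite mulrACA -exprD subnKC // -ltnS.
Qed.

(** Unlike d/dt, the derivation t d/dt commutes with every substitution t -> x t. *)
Definition fps_euler f : fps R := Fps (fun n => fcoef f n *+ n).

Lemma fps_eulerM f g :
  fps_euler (f * g) = fps_euler f * g + f * fps_euler g.
Proof.
apply: fpsP => n; rewrite /= -sumrMnl -big_split /=; apply: eq_bigr => j _.
by rewrite mulrnAl mulrnAr -mulrnDr subnKC // -ltnS.
Qed.

Lemma fps_euler1 : fps_euler 1 = 0.
Proof. by apply: fpsP => -[|n] //=; rewrite mul0rn. Qed.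

Lemma fps_euler_dilate x f : fps_euler (fps_dilate x f) = fps_dilate x (fps_euler f).
Proof. by apply: fpsP => n; rewrite /= mulrnAr. Qed.

Lemma fps_euler_prod (I : Type) (r : seq I) (F L : I -> fps R) :
  (forall i, fps_euler (F i) = F i * L i) ->
  fps_euler (\prod_(i <- r) F i) = \prod_(i <- r) F i * \sum_(i <- r) L i.
Proof.
move=> FL; elim: r => [|i r IHr]; first by rewrite !big_nil mulr0 fps_euler1.
by rewrite !big_cons fps_eulerM FL IHr mulrDr mulrA mulrAC.
Qed.

(** Applying D to f g = 1 gives (D f) g + s = 0; multiplying by f, the inverse of g, isolates D
    f. *)
Lemma fps_euler_inv f g s :
  f * g = 1 -> fps_euler g = g * s -> fps_euler f = f * - s.
Proof.
move=> fg1 gs; have := fps_eulerM f g.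
rewrite fg1 fps_euler1 gs mulrA fg1 mul1r => /esym/eqP.
rewrite addr_eq0 => /eqP fgs.
by rewrite -[LHS]mulr1 -fg1 mulrCA fgs.
Qed.

Definition fps_of_poly (p : {poly R}) : fps R := Fps (fun n => p`_n).

Fact fps_of_poly_is_zmod_morphism : zmod_morphism fps_of_poly.
Proof. by move=> p q; apply: fpsP => n; rewrite /= coefB. Qed.

Fact fps_of_poly_is_monoid_morphism : monoid_morphism fps_of_poly.
Proof. by split=> [|p q]; apply: fpsP => n; rewrite /= ?coef1 ?coefM. Qed.

HB.instance Definition _ :=
  GRing.isZmodMorphism.Build _ _ fps_of_poly fps_of_poly_is_zmod_morphism.
HB.instance Definition _ :=
  GRing.isMonoidMorphism.Build _ _ fps_of_poly fps_of_poly_is_monoid_morphism.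

End FpsOperations.

Arguments fps_dilate {R} x f.
Arguments fps_euler {R} f.
Arguments fps_of_poly {R} p.

Section MapFps.
Variables (A B : comNzRingType) (u : {rmorphism A -> B}).

Lemma map_fpsM (f g : fps A) : map_fps u (f * g) = map_fps u f * map_fps u g.
Proof.
apply: fpsP => n; rewrite /= rmorph_sum; apply: eq_bigr => j _.
by rewrite rmorphM.
Qed.

Lemma fps_euler_map (f : fps A) : fps_euler (map_fps u f) = map_fps u (fps_euler f).
Proof. by apply: fpsP => n; rewrite /= rmorphMn. Qed.

End MapFps.

(** Over a rational algebra n f_n = 0 forces f_n = 0 for n > 0, so D kills only constants. *)
Lemma fps_euler_eq0 (R : comAlgType rat) (f : fps R) :
  fps_euler f = 0 -> fcoef f 0 = 1 -> f = 1.
Proof.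
move=> Df0 f0; apply: fpsP => -[|n] //.
have /(congr1 (fun h => n.+1%:R^-1 *: fcoef h n.+1)) := Df0.
rewrite /= -scaler_nat scalerA mulVf ?Num.Theory.pnatr_eq0 // scale1r.
by rewrite scaler0.
Qed.

(** * The logarithmic derivative of 1 + t + ... + t^d *)

Definition geom_trunc (d : nat) : fps rat := Fps (fun n => (n <= d)%:R).

Lemma geom_trunc_unit d : geom_trunc d \is a GRing.unit.
Proof. exact: fps_unit_coef0. Qed.

(* Locked because simplification would expand the coefficients of the product. *)
HB.lock Definition geom_logder (d : nat) : fps rat :=
  (geom_trunc d)^-1 * fps_euler (geom_trunc d).

Lemma fps_euler_geom_trunc d :
  fps_euler (geom_trunc d) = geom_trunc d * geom_logder d.
Proof. by rewrite geom_logder.unlock mulrA divrr ?mul1r ?geom_trunc_unit. Qed.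

Lemma geom_logder0 d : fcoef (geom_logder d) 0 = 0.
Proof. by rewrite geom_logder.unlock fcoef0M /= mulr0. Qed.

(** Here g = 1 + t and C = t / (1 + t): comparing coefficients in D g = g C gives c_1 = 1 and
    c_(m+2) = - c_(m+1). *)
Lemma geom_logder1_neq0 n : fcoef (geom_logder 1) n.+1 != 0.
Proof.
have coefE m : (m.+1 <= 1)%N%:R *+ m.+1 =
    fcoef (geom_logder 1) m.+1 + fcoef (geom_logder 1) m :> rat.
  have /(congr1 (fun f => fcoef f m.+1)) := fps_euler_geom_trunc 1.
  (* Only the last two terms of the convolution survive, as 1 + t has degree 1. *)
  rewrite mulrC fcoefM big_ord_recr big_ord_recr /= => ->.
  rewrite subnn (subSnn m) big1 ?add0r ?mulr1 1?addrC // => j _.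
  by rewrite leqNgt ltn_subRL addn1 ltnS ltn_ord mulr0.
elim: n => [|n IHn]; have := coefE _.
  by move=> /(_ 0%N); rewrite geom_logder0 addr0 => <-.
move=> /(_ n.+1) /eqP; rewrite /= mul0rn eq_sym addr_eq0 => /eqP ->.
by rewrite oppr_eq0.
Qed.

(* The exponent is shifted because p_0 = N is not stable in N. *)
Fact power_sum_subproof n :
  is_symfun (fun N => \sum_(k < N) ('X_k : {mpoly rat[N]}) ^+ n.+1).
Proof.
split=> [N|N|].
- apply/issymP => s; rewrite rmorph_sum /= [RHS](reindex_inj (@perm_inj _ s)) /=.
  by apply: eq_bigr => k _; rewrite rmorphXn /= /msym mmapX mmap1U.
- rewrite rmorph_sum big_ord_recr /= rmorphXn /= /mrestrict comp_mpolyXU -tnth_nth.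
  rewrite tnth_mktuple unlift_none expr0n addr0; apply: eq_bigr => k _.
  rewrite rmorphXn /= /mrestrict comp_mpolyXU -tnth_nth tnth_mktuple.
  have -> : widen_ord (leqnSn N) k = lift ord_max k.
    by apply: val_inj; rewrite /= /bump leqNgt ltn_ord.
  by rewrite liftK.
exists n.+2 => N; apply: leq_trans (msize_sum _ _ _) _.
by apply/bigmax_leqP => k _; rewrite mpolyXn msizeX mdegMn mdeg1 mul1n.
Qed.

Definition power_sum n : symfun := SymFun (power_sum_subproof n).

(** * Reduction to finitely many variables *)

Definition symfun_trunc N (f : symfun) : {mpoly rat[N]} := f N.

Fact symfun_trunc_is_zmod_morphism N : zmod_morphism (symfun_trunc N).
Proof. by []. Qed.

Fact symfun_trunc_is_monoid_morphism N : monoid_morphism (symfun_trunc N).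
Proof. by []. Qed.

HB.instance Definition _ N :=
  GRing.isZmodMorphism.Build _ _ (symfun_trunc N) (symfun_trunc_is_zmod_morphism N).
HB.instance Definition _ N :=
  GRing.isMonoidMorphism.Build _ _ (symfun_trunc N) (symfun_trunc_is_monoid_morphism N).

(** The series of all c_n p_n t^n. At n = 0 the predecessor is 0 and the entry is p_1, but its
    coefficient c_0 is 0. *)
Definition Hd_logder d : fps symfun :=
  Fps (fun n => fcoef (geom_logder d) n *: power_sum n.-1).

Lemma Hd_trunc d N :
  map_fps (symfun_trunc N) (Hd d) =
  \prod_(k < N) fps_dilate 'X_k (map_fps (in_alg {mpoly rat[N]}) (geom_trunc d)).
Proof.
transitivity (fps_of_poly (Hd_poly d N)); first exact: fpsP.
rewrite rmorph_prod; apply: eq_bigr => k _; apply: fpsP => n /=.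
rewrite coef_sum.
under eq_bigr => i _ do rewrite coefZ coefXn.
have [led | ltd] := leqP n d.
  rewrite (bigD1 (Ordinal (led : (n < d.+1)%N))) //= eqxx big1 ?addr0 ?scale1r //.
  by move=> i; rewrite -val_eqE eq_sym /= => /negPf ->; rewrite mulr0.
rewrite scale0r mulr0 big1 // => i _; case: eqP => [ni|]; last by rewrite mulr0.
by have := ltn_ord i; rewrite -ni ltnS leqNgt ltd.
Qed.

Lemma Hd_logder_trunc d N :
  map_fps (symfun_trunc N) (Hd_logder d) =
  \sum_(k < N) fps_dilate 'X_k (map_fps (in_alg {mpoly rat[N]}) (geom_logder d)).
Proof.
apply: fpsP => -[|n]; rewrite fcoef_sum /= /symfun_trunc /=.
  rewrite geom_logder0 scale0r big1 // => k _.
  by rewrite scale0r mulr0.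
by rewrite scaler_sumr; apply: eq_bigr => k _; rewrite mulr_algr.
Qed.

(** It suffices to compare N-variable truncations, where the product is finite and its k-th factor
    g(x_k t) has logarithmic derivative C(x_k t). *)
Lemma fps_euler_Hd d : fps_euler (Hd d) = Hd d * Hd_logder d.
Proof.
apply: fpsP => n; apply: symfunP => N.
suff /(congr1 (fun f => fcoef f n)) : map_fps (symfun_trunc N) (fps_euler (Hd d)) =
    map_fps (symfun_trunc N) (Hd d * Hd_logder d) by [].
rewrite map_fpsM -fps_euler_map Hd_trunc Hd_logder_trunc.
apply: fps_euler_prod => k.
by rewrite fps_euler_dilate fps_euler_map fps_euler_geom_trunc map_fpsM fps_dilateM.
Qed.

Lemma Hd_coef0 d : fcoef (Hd d) 0 = 1.
Proof.
apply: symfunP => N /=; rewrite -horner_coef0 horner_prod big1 // => k _.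
rewrite horner_coef0 coef_sum big_ord_recl /= big1 => [|i _].
  by rewrite coefZ coefXn expr0 mulr1 addr0.
by rewrite coefZ coefXn mulr0.
Qed.

(** * The action of omega *)

Section Omega.
Variable omega : {lrmorphism symfun -> symfun}.
Hypothesis omega_e : forall n, omega (sf_e n) = sf_h n.

Lemma map_omega_Eseries : map_fps omega Eseries = Hseries.
Proof. by apply: fpsP => n; apply: omega_e. Qed.

(** The sign is (-1)^n because [power_sum n] is p_(n+1). D H is computed once from H(t) E(-t) = 1
    and once from H = omega(E), and the unit H is cancelled. *)
Lemma omega_power_sum n : omega (power_sum n) = (-1) ^+ n *: power_sum n.
Proof.
have HE1 : Hseries * fps_reflect Eseries = 1 by rewrite mulVr ?Hd_reflect_unit.
have logder_H : fps_euler Hseries = Hseries * - fps_reflect (Hd_logder 1).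
  apply: (@fps_euler_inv _ _ _ _ HE1).
  rewrite -[fps_reflect Eseries]/(fps_dilate (-1) (Hd 1)).
  by rewrite fps_euler_dilate fps_euler_Hd fps_dilateM.
have logder_omega : fps_euler Hseries = Hseries * map_fps omega (Hd_logder 1).
  by rewrite -map_omega_Eseries fps_euler_map fps_euler_Hd map_fpsM.
have: map_fps omega (Hd_logder 1) = - fps_reflect (Hd_logder 1).
  have Hunit : Hseries \is a GRing.unit by rewrite unitrV Hd_reflect_unit.
  by apply: (mulrI Hunit); rewrite -logder_omega.
(* The coefficient of t^(n+1) reads c_(n+1) omega(p_(n+1)) = (-1)^n c_(n+1) p_(n+1). *)
move=> /(congr1 (fun f => fcoef f n.+1)) /=; rewrite linearZ /=.
rewrite exprS mulN1r mulNr opprK -scalerAr => /(scalerI (geom_logder1_neq0 n)) ->.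
by rewrite -!(signr_odd _ n) scaler_sign mulr_sign.
Qed.

Lemma map_omega_Hd_logder d :
  map_fps omega (Hd_logder d) = - fps_reflect (Hd_logder d).
Proof.
apply: fpsP => -[|n]; rewrite /= linearZ /= ?geom_logder0.
  by rewrite !scale0r mulr0 oppr0.
rewrite omega_power_sum exprS mulN1r mulNr opprK -scalerAr.
by rewrite -!(signr_odd _ n) scaler_sign mulr_sign.
Qed.

Lemma map_omega_HdM d : map_fps omega (Hd d) * fps_reflect (Hd d) = 1.
Proof.
rewrite -[fps_reflect _]/(fps_dilate (-1) (Hd d)).
apply: fps_euler_eq0.
  (* By Leibniz the product gets multiplied by the sum of two opposite logarithmic derivatives. *)
  rewrite fps_eulerM fps_euler_map fps_euler_dilate fps_euler_Hd map_fpsM.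
  rewrite map_omega_Hd_logder fps_dilateM mulrN mulNr mulrA mulrAC addrC.
  exact: subrr.
rewrite fcoef0M -[fcoef (map_fps _ _) 0]/(omega (fcoef (Hd d) 0)).
by rewrite -[fcoef (fps_dilate _ _) 0]/(1 * fcoef (Hd d) 0) Hd_coef0 rmorph1 !mulr1.
Qed.

End Omega.

Theorem theorem3p1 (omega : {lrmorphism symfun -> symfun})
    (omegaK : involutive omega)
    (omega_e : forall n : nat, omega (sf_e n) = sf_h n) :
  (forall d : nat, (0 < d)%N ->
     map_fps omega (Hd d) = (fps_reflect (Hd d))^-1) /\
  map_fps omega Eseries = Hseries.
Proof.
split=> [d _|]; last exact: map_omega_Eseries.
by apply/esym/mulr1_eq; rewrite mulrC map_omega_HdM.
Qed.
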